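(* Let $\mathcal A$ be an injective Banach operator ideal and $1\le\lambda<\infty$. Then a Banach space $X$ has the weak $\lambda$-BAP for $\mathcal A$ if and only if $X$ has the local $\lambda$-BAP for $\mathcal A$.
   Context: All Banach spaces are over the same field, real or complex. $\mathcal F(X;Y)$ denotes the finite rank bounded operators, $\mathcal F(X)=\mathcal F(X;X)$. A Banach operator ideal $(\mathcal A,\|\cdot\|_{\mathcal A})$ is injective if for every isometric embedding $J\colon Y\to Z$ and every bounded operator $T\colon X\to Y$ with $JT\in\mathcal A(X;Z)$ one has $T\in\mathcal A(X;Y)$ and $\|T\|_{\mathcal A}=\|JT\|_{\mathcal A}$. $X$ has the weak $\lambda$-BAP for $\mathcal A$ if for every Banach space $Y$ and each $T\in\mathcal A(X;Y)$ there is a net $(S_\alpha)$ in $\mathcal F(X)$ such that $S_\alpha\to I_X$ pointwise and $\limsup_\alpha\|TS_\alpha\|_{\mathcal A}\le\lambda\|T\|_{\mathcal A}$. $X$ has the local $\lambda$-BAP for $\mathcal A$ if for every Banach space $Y$ and each $T\in\mathcal A(X;Y)$ there is a net $(T_\alpha)$ in $\mathcal F(X;Y)$ such that $T_\alpha\to T$ pointwise and $\limsup_\alpha\|T_\alpha\|_{\mathcal A}\le\lambda\|T\|_{\mathcal A}$. *)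

(* Defs.v *)
From HB Require Import structures.
From mathcomp Require Import all_boot all_order all_algebra.
From mathcomp Require Import complex.
From mathcomp Require Import all_classical all_reals all_analysis.

Set Implicit Arguments.
Unset Strict Implicit.
Unset Printing Implicit Defensive.

Import Order.TTheory GRing.Theory Num.Theory numFieldNormedType.Exports.

Local Open Scope classical_set_scope.
Local Open Scope ring_scope.

Inductive scalars := RealScalars | ComplexScalars.

Definition scalar_field (R : realType) (s : scalars) : numFieldType :=
  match s with
  | RealScalars => R
  | ComplexScalars => complex R
  end.

Definition scalar_re (R : realType) (s : scalars) : scalar_field R s -> R :=
  match s return scalar_field R s -> R with
  | RealScalars => fun x => x
  | ComplexScalars => fun z => complex.Re z
  end.

Notation banachType R s := (completeNormedModType (scalar_field R s)).

                                                                              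
                                                                    
Definition rnorm (R : realType) (s : scalars)
  (X : normedModType (scalar_field R s)) (x : X) : R := scalar_re `|x|.

Section operators.
Variables (R : realType) (s : scalars).
Implicit Types X Y : normedModType (scalar_field R s).

Definition bounded_operator X Y (T : X -> Y) : Prop :=
  linear T /\ exists M : R, forall x, rnorm (T x) <= M * rnorm x.

Definition opnorm X Y (T : X -> Y) : R :=
  sup [set rnorm (T x) | x in [set x | rnorm x <= 1]].

Definition isometric_embedding X Y (J : X -> Y) : Prop :=
  linear J /\ forall x, `|J x| = `|x|.

Definition finite_rank X Y (T : X -> Y) : Prop :=
  bounded_operator T /\
  exists (n : nat) (y : 'I_n -> Y), forall x,
    exists c : 'I_n -> scalar_field R s, T x = \sum_(i < n) c i *: y i.

Definition rank_one X Y (phi : X -> (scalar_field R s)^o) (y : Y) : X -> Y :=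
  fun x => phi x *: y.

End operators.

                                                                              
                                  
Record banach_ideal (R : realType) (s : scalars) := BanachIdeal {
  ideal_mem : forall X Y : banachType R s, set (X -> Y) ;
  ideal_norm : forall X Y : banachType R s, (X -> Y) -> R ;
  ideal_mem_bounded : forall (X Y : banachType R s) (T : X -> Y),
    ideal_mem T -> bounded_operator T ;
  ideal_memD : forall (X Y : banachType R s) (T U : X -> Y),
    ideal_mem T -> ideal_mem U -> ideal_mem (T \+ U) ;
  ideal_memZ : forall (X Y : banachType R s) (a : scalar_field R s)
      (T : X -> Y),
    ideal_mem T -> ideal_mem (a \*: T) ;
  ideal_mem_rank_one : forall (X Y : banachType R s)
      (phi : X -> (scalar_field R s)^o) (y : Y),
    bounded_operator phi -> ideal_mem (rank_one phi y) ;
  ideal_mem_comp : forall (W X Y Z : banachType R s)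
      (U : W -> X) (T : X -> Y) (V : Y -> Z),
    bounded_operator U -> ideal_mem T -> bounded_operator V ->
    ideal_mem (V \o T \o U) ;
  ideal_norm_ge0 : forall (X Y : banachType R s) (T : X -> Y),
    ideal_mem T -> 0 <= ideal_norm T ;
  ideal_norm_eq0 : forall (X Y : banachType R s) (T : X -> Y),
    ideal_mem T -> ideal_norm T = 0 -> forall x, T x = 0 ;
  ideal_normD : forall (X Y : banachType R s) (T U : X -> Y),
    ideal_mem T -> ideal_mem U ->
    ideal_norm (T \+ U) <= ideal_norm T + ideal_norm U ;
  ideal_normZ : forall (X Y : banachType R s) (a : scalar_field R s)
      (T : X -> Y),
    ideal_mem T ->
    ideal_norm (a \*: T) = scalar_re `|a| * ideal_norm T ;
  ideal_norm_rank_one : forall (X Y : banachType R s)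
      (phi : X -> (scalar_field R s)^o) (y : Y),
    bounded_operator phi -> ideal_norm (rank_one phi y) = opnorm phi * rnorm y ;
  ideal_norm_comp : forall (W X Y Z : banachType R s)
      (U : W -> X) (T : X -> Y) (V : Y -> Z),
    bounded_operator U -> ideal_mem T -> bounded_operator V ->
    ideal_norm (V \o T \o U) <= opnorm V * ideal_norm T * opnorm U ;
  ideal_complete : forall (X Y : banachType R s) (T : nat -> X -> Y),
    (forall n, ideal_mem (T n)) ->
    (forall e : R, 0 < e -> exists N : nat, forall m n : nat,
      (N <= m)%N -> (N <= n)%N -> ideal_norm (T m \- T n) < e) ->
    exists2 U : X -> Y, ideal_mem U &
      ideal_norm (T n \- U) @[n --> \oo] --> (0 : R)
}.

Definition injective_ideal (R : realType) (s : scalars)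
    (A : banach_ideal R s) : Prop :=
  forall (X Y Z : banachType R s) (J : Y -> Z) (T : X -> Y),
    isometric_embedding J -> bounded_operator T -> ideal_mem A (J \o T) ->
    ideal_mem A T /\ ideal_norm A T = ideal_norm A (J \o T).

Record directedType := DirectedType {
  dir_sort :> Type ;
  dir_le : dir_sort -> dir_sort -> Prop ;
  dir_inhabited : inhabited dir_sort ;
  dir_refl : forall a, dir_le a a ;
  dir_trans : forall a b c, dir_le a b -> dir_le b c -> dir_le a c ;
  dir_ub : forall a b, exists c, dir_le a c /\ dir_le b c
}.

                                                         
Definition dir_tails (D : directedType) : set_system D :=
  filter_from setT (fun a => [set b | dir_le a b]).
Arguments dir_tails D : clear implicits.

Definition net_limsup (R : realType) (D : directedType) (f : D -> R) : \bar R :=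
  ereal_inf [set ereal_sup [set (f b)%:E | b in [set b | dir_le a b]]
            | a in [set: D]].

Definition weak_BAP (R : realType) (s : scalars) (lambda : R)
    (A : banach_ideal R s) (X : banachType R s) : Prop :=
  forall (Y : banachType R s) (T : X -> Y), ideal_mem A T ->
  exists (D : directedType) (S : D -> X -> X),
    [/\ forall a, finite_rank (S a),
        forall x, S a x @[a --> dir_tails D] --> x &
        (net_limsup (fun a => ideal_norm A (T \o S a))
          <= (lambda * ideal_norm A T)%:E)%E].

Definition local_BAP (R : realType) (s : scalars) (lambda : R)
    (A : banach_ideal R s) (X : banachType R s) : Prop :=
  forall (Y : banachType R s) (T : X -> Y), ideal_mem A T ->
  exists (D : directedType) (S : D -> X -> Y),
    [/\ forall a, finite_rank (S a),
        forall x, S a x @[a --> dir_tails D] --> T x &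
        (net_limsup (fun a => ideal_norm A (S a))
          <= (lambda * ideal_norm A T)%:E)%E].

(* Main.v *)
Require Import Defs.
From HB Require Import structures.
From mathcomp Require Import all_boot all_order all_algebra.
From mathcomp Require Import complex.
From mathcomp Require Import all_classical all_reals all_analysis.
From mathcomp Require Import ring lra.

(** The weak property implies the local one by composing the approximating
    operators S on X with T. The converse has to turn finite rank operators
    U : X -> Y close to T into finite rank operators S on X close to the
    identity with the ideal norm of T S under control.

    Injectivity makes it possible to replace Y by the closure of the range of
    T without changing any of the ideal norms involved, so T may be assumed to
    have dense range. Then a finite rank U, a finite sum of elementary operators
    psi_j (.) y_j, is approximated in the ideal norm by operators T S with S of
    finite rank: replace each y_j by T x_j with T x_j close to y_j
    ([rank_one_sum_lift]).

    This gives T S close to T on given points, but not S close to the identity.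
    To repair it, take finitely many points of X and a finite rank P fixing
    them, and pass to P + S (I - P), which fixes them too. The identity

      T (P + S (I - P)) = U + (T - U) P + (T S - U) (I - P)

    shows that the ideal norm is hardly affected: if P is the sum of the
    elementary operators phi_i (.) e_i, then (T - U) P is the sum of the
    phi_i (.) (T - U) e_i, which is small in the ideal norm as soon as U is close
    to T at the points e_i ([ideal_norm_net_comp]), and
    the last term is small by the choice of S ([dense_range_approximation]).
    The net of the weak property is indexed by finite lists of points of X
    together with a tolerance 1 / (n + 1).

    The operator P exists because bounded functionals separate points, over the
    reals and over the complex numbers; this is the Hahn-Banach theorem, proved
    here through minimal sublinear functionals. *)

Set Implicit Arguments.
Unset Strict Implicit.
Unset Printing Implicit Defensive.

Import Order.TTheory GRing.Theory Num.Theory numFieldNormedType.Exports.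

Local Open Scope classical_set_scope.
Local Open Scope ring_scope.

(** * The Hahn-Banach theorem over the reals *)

Section hahn_banach.
Variables (R : realType) (V : lmodType R).
Implicit Types (p q : V -> R) (x y : V).

(** Homogeneity is only required as an inequality for positive factors; the
    equality, and p 0 = 0, follow by applying it to the inverse factor. *)
Definition sublinear p :=
  (forall x y, p (x + y) <= p x + p y) /\
  (forall a x, 0 < a -> p (a *: x) <= a * p x).

Lemma sublinear0 p : sublinear p -> p 0 = 0.
Proof.
move=> [_ pZ]; have := pZ 2 0 (ltr0Sn _ 1); have := pZ 2^-1 0.
by rewrite !scaler0 invr_gt0 ltr0Sn => /(_ isT); lra.
Qed.

Lemma sublinearZ p a x : sublinear p -> 0 <= a -> p (a *: x) = a * p x.
Proof.
move=> sp; rewrite le_eqVlt => /predU1P[<-|a0].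
  by rewrite scale0r mul0r sublinear0.
apply/eqP; rewrite eq_le sp.2//= mulrC -ler_pdivlMr// mulrC.
rewrite -{1}[x]scale1r -(mulVf (lt0r_neq0 a0)) -scalerA.
by apply: sp.2; rewrite invr_gt0.
Qed.

Lemma sublinear_opp p x : sublinear p -> - p (- x) <= p x.
Proof.
move=> sp; have := sp.1 x (- x); rewrite subrr sublinear0//; lra.
Qed.

Lemma le_inf_add (A B : set R) (c : R) : A !=set0 -> B !=set0 ->
  (forall a b, A a -> B b -> c <= a + b) -> c <= inf A + inf B.
Proof.
move=> A0 B0 cAB; rewrite -lerBlDr; apply: lb_le_inf => // a Aa.
rewrite lerBlDr addrC -lerBlDr; apply: lb_le_inf => // b Bb.
by rewrite lerBlDr addrC; exact: cAB.
Qed.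

(** The largest sublinear functional q below p that satisfies q (- y) <= - p y:
    passing from p to it makes p linear along the line spanned by y. *)
Definition flattening p y x : R :=
  inf [set p (x + t *: y) - t * p y | t in [set t | 0 <= t]].

Lemma flattening_le p y t x : sublinear p -> 0 <= t ->
  flattening p y x <= p (x + t *: y) - t * p y.
Proof.
move=> sp t0; apply: ge_inf; last by exists t.
(* subadditivity bounds the defining set below by - p (- x) *)
exists (- p (- x)) => _ [r /= r0 <-].
rewrite -(sublinearZ y sp r0); have := sp.1 (x + r *: y) (- x).
by rewrite addrAC subrr add0r; lra.
Qed.

Lemma le_flattening p y x c :
  (forall t, 0 <= t -> c <= p (x + t *: y) - t * p y) -> c <= flattening p y x.
Proof.
move=> cp; apply: lb_le_inf => [|_ [t /= t0 <-]]; last exact: cp.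
by exists (p (x + 0 *: y) - 0 * p y), 0 => /=.
Qed.

Lemma flattening_sublinear p y : sublinear p -> sublinear (flattening p y).
Proof.
move=> sp; split=> [x x'|a x a0].
  apply: le_inf_add => [||_ _ [t /= t0 <-] [r /= r0 <-]].
  - by exists (p (x + 0 *: y) - 0 * p y), 0 => /=.
  - by exists (p (x' + 0 *: y) - 0 * p y), 0 => /=.
  have := flattening_le y (x + x') sp (addr_ge0 t0 r0).
  have := sp.1 (x + t *: y) (x' + r *: y).
  by rewrite addrACA -scalerDl; lra.
rewrite mulrC -ler_pdivrMr//; apply: le_flattening => t t0.
rewrite ler_pdivrMr//; have := flattening_le y (a *: x) sp (mulr_ge0 (ltW a0) t0).
move/le_trans; apply; rewrite -scalerA -scalerDr (sublinearZ _ sp (ltW a0)).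
by rewrite le_eqVlt; apply/orP; left; apply/eqP; ring.
Qed.

(** Zorn's lemma applies because the pointwise infimum of a chain is again
    sublinear: comparability of two members is what makes it subadditive, and
    - p (- x) bounds all values at x below. *)
Lemma minimal_sublinear p : sublinear p ->
  exists q, [/\ sublinear q, forall x, q x <= p x &
    forall q', sublinear q' -> (forall x, q' x <= q x) -> q' = q].
Proof.
move=> sp; pose T := {q | sublinear q /\ forall x, q x <= p x}.
pose mkT q (sq : sublinear q) (qp : forall x, q x <= p x) : T :=
  exist _ q (conj sq qp).
pose le_T (f g : T) := `[< forall x, sval g x <= sval f x >].
have [||||q qmin] := @Zorn T le_T.
- by move=> t; apply/asboolP.
- move=> r t u /asboolP rt /asboolP tu; apply/asboolP => x.
  exact: le_trans (tu x) (rt x).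
- move=> [f Pf] [g Pg] /asboolP/= fg /asboolP/= gf; apply: eq_exist.
  by apply/funext => x; apply/eqP; rewrite eq_le fg gf.
- move=> C Ctot.
  (* adding p itself makes the chain nonempty *)
  pose C' : set T := [set f | f = mkT p sp (fun=> lexx _) \/ C f].
  have C'tot f g : C' f -> C' g -> le_T f g \/ le_T g f.
    move=> [->|Cf] [->|Cg]; last exact: Ctot.
    - by left; apply/asboolP => x /=.
    - by left; apply/asboolP => x /=; exact: (svalP g).2.
    - by right; apply/asboolP => x /=; exact: (svalP f).2.
  pose E x := [set sval f x | f in C'].
  have E0 x : E x !=set0 by exists (p x), (mkT p sp (fun=> lexx _)) => //; left.
  have Ele f x : C' f -> inf (E x) <= sval f x.
    move=> Cf; apply: ge_inf; last by exists f.
    exists (- p (- x)) => _ [[g [sg gp]] Cg <-] /=.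
    by apply: le_trans (sublinear_opp _ sg); rewrite lerN2.
  have sE : sublinear (fun x => inf (E x)).
    split=> [x y|a x a0].
      apply: le_inf_add => // _ _ [f Cf <-] [g Cg <-].
      have [/asboolP fg|/asboolP gf] := C'tot f g Cf Cg.
        apply: le_trans (Ele g (x + y) Cg) (le_trans ((svalP g).1.1 _ _) _).
        by rewrite lerD2r.
      apply: le_trans (Ele f (x + y) Cf) (le_trans ((svalP f).1.1 _ _) _).
      by rewrite lerD2l.
    rewrite mulrC -ler_pdivrMr//; apply: lb_le_inf => // _ [f Cf <-].
    rewrite ler_pdivrMr// mulrC.
    exact: le_trans (Ele f _ Cf) ((svalP f).1.2 _ _ a0).
  have Ep x : inf (E x) <= p x by apply: (Ele (mkT p sp _)); left.
  exists (mkT _ sE Ep) => f Cf; apply/asboolP => x /=.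
  by apply: Ele; right.
exists (sval q); split; [exact: (svalP q).1|exact: (svalP q).2|].
move=> q' sq' q'q; have q'p x : q' x <= p x := le_trans (q'q x) ((svalP q).2 x).
by rewrite -(qmin (mkT q' sq' q'p))//; exact/asboolP.
Qed.

(** A minimal sublinear functional u equals all its flattenings, and
    [flattening_le] at t = 1 then says that u is additive. Minimality is taken
    below the flattening of p along v, whose value at - v is at most - p v; this
    forces u v = p v. *)
Theorem hahn_banach p v : sublinear p ->
  exists u : V -> R, [/\ scalar u, forall x, u x <= p x & u v = p v].
Proof.
move=> sp.
have [u [su ule umin]] := minimal_sublinear (flattening_sublinear v sp).
have up x : u x <= p x.
  apply: le_trans (ule x) _.
  by have := flattening_le v x sp (lexx 0); rewrite scale0r mul0r addr0 subr0.
have uflat y : flattening u y = u.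
  apply: umin => [|x]; first exact: flattening_sublinear.
  by have := flattening_le y x su (lexx 0); rewrite scale0r mul0r addr0 subr0.
have uD x y : u (x + y) = u x + u y.
  apply/eqP; rewrite eq_le su.1 /=.
  have := flattening_le y x su ler01; rewrite uflat scale1r mul1r; lra.
have uN x : u (- x) = - u x.
  by have := uD x (- x); rewrite subrr (sublinear0 su); lra.
exists u; split=> //.
  move=> a x y; rewrite uD; congr (_ + _).
  have [a0|a0] := leP 0 a; first exact: sublinearZ.
  rewrite -[a *: x]opprK -scaleNr uN (sublinearZ _ su) ?oppr_ge0 ?ltW//.
  by rewrite mulNr opprK.
apply/eqP; rewrite eq_le up /= -lerN2 -uN.
apply: le_trans (ule _) _; have := flattening_le v (- v) sp ler01.
by rewrite scale1r addNr mul1r (sublinear0 sp) sub0r.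
Qed.

End hahn_banach.

(** * The scalar field as an extension of the reals *)

Section scalars.
Variables (R : realType) (s : scalars).
Notation K := (scalar_field R s).

Definition of_real : R -> K :=
  match s return R -> scalar_field R s with
  | RealScalars => id
  | ComplexScalars => real_complex R
  end.

Lemma of_realK a : scalar_re (of_real a) = a.
Proof. by rewrite /of_real; case: s. Qed.

Lemma of_realD a b : of_real (a + b) = of_real a + of_real b.
Proof. by rewrite /of_real; case: s => //=; rewrite rmorphD. Qed.

Lemma of_realM a b : of_real (a * b) = of_real a * of_real b.
Proof. by rewrite /of_real; case: s => //=; rewrite rmorphM. Qed.

Lemma of_real1 : of_real 1 = 1.
Proof. by rewrite /of_real; case: s => //=. Qed.

Lemma ler_of_real a b : (of_real a <= of_real b) = (a <= b).
Proof. by rewrite /of_real; case: s => //=; rewrite lecR. Qed.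

Lemma of_real_inj : injective of_real.
Proof. exact: can_inj of_realK. Qed.

Lemma ltr_of_real a b : (of_real a < of_real b) = (a < b).
Proof. by rewrite !lt_neqAle ler_of_real (inj_eq of_real_inj). Qed.

Lemma of_real0 : of_real 0 = 0.
Proof. by apply: (addrI (of_real 0)); rewrite -of_realD !addr0. Qed.

Lemma scalar_reK (z : K) : 0 <= z -> of_real (scalar_re z) = z.
Proof.
rewrite /of_real /scalar_re; case: s z => //= -[a b].
by rewrite lecE/= => /andP[/eqP-> _].
Qed.

End scalars.

Section rnorm.
Variables (R : realType) (s : scalars).
Notation K := (scalar_field R s).
Implicit Types X : normedModType K.

Lemma norm_rnorm X (x : X) : `|x| = of_real s (rnorm x).
Proof. by rewrite scalar_reK. Qed.

Lemma rnorm_ge0 X (x : X) : 0 <= rnorm x.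
Proof. by rewrite -(ler_of_real s) -norm_rnorm of_real0. Qed.

Lemma rnormD X (x y : X) : rnorm (x + y) <= rnorm x + rnorm y.
Proof. by rewrite -(ler_of_real s) of_realD -!norm_rnorm ler_normD. Qed.

Lemma rnormN X (x : X) : rnorm (- x) = rnorm x.
Proof. by rewrite /rnorm normrN. Qed.

Lemma rnormZ X (a : K) (x : X) :
  rnorm (a *: x) = rnorm (a : K^o) * rnorm x.
Proof. by apply: (@of_real_inj R s); rewrite of_realM -!norm_rnorm normrZ. Qed.

Lemma rnorm0 X : rnorm (0 : X) = 0.
Proof. by apply: (@of_real_inj R s); rewrite of_real0 -norm_rnorm normr0. Qed.

Lemma rnorm_of_real a : 0 <= a -> rnorm (of_real s a : K^o) = a.
Proof.
move=> a0; apply: (@of_real_inj R s); rewrite -norm_rnorm ger0_norm//.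
by rewrite -(of_real0 R s) ler_of_real.
Qed.

Lemma rnorm_gt0 X (x : X) : x != 0 -> 0 < rnorm x.
Proof.
by rewrite -(ltr_of_real s) of_real0 -norm_rnorm normr_gt0.
Qed.

Lemma cvg_rnormP X (T : Type) (F : set_system T) (FF : Filter F) (f : T -> X)
    (l : X) :
  f @ F --> l <-> forall e : R, 0 < e -> \forall t \near F, rnorm (f t - l) < e.
Proof.
split=> [/cvgrPdistC_lt fl e e0|fl].
  have e0' : 0 < of_real s e by rewrite -(of_real0 R s) ltr_of_real.
  by have := fl _ e0'; apply: filterS => t; rewrite norm_rnorm ltr_of_real.
apply/cvgrPdistC_lt => e e0; have := fl (scalar_re e).
rewrite -(ltr_of_real s) of_real0 scalar_reK ?ltW// => /(_ e0).
by apply: filterS => t; rewrite -(ltr_of_real s) -norm_rnorm scalar_reK ?ltW.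
Qed.

End rnorm.

(** * Bounded functionals separate points *)

Section restriction_of_scalars.
Variables (R : realType) (s : scalars) (X : lmodType (scalar_field R s)).

(** A copy of X under another name, so that scaling by reals does not clash
    with scaling by the field that X already carries. *)
Definition realification : Type := X.

HB.instance Definition _ := GRing.Zmodule.copy realification X.

Definition real_scale (a : R) (x : realification) : realification :=
  of_real s a *: (x : X).

Lemma real_scaleA a b x : real_scale a (real_scale b x) = real_scale (a * b) x.
Proof. by rewrite /real_scale scalerA of_realM. Qed.

Lemma real_scale1 : left_id 1 real_scale.
Proof. by move=> x; rewrite /real_scale of_real1 scale1r. Qed.

Lemma real_scaleDr : right_distributive real_scale +%R.
Proof. by move=> a x y; rewrite /real_scale scalerDr. Qed.

Lemma real_scaleDl x : {morph real_scale^~ x : a b / a + b}.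
Proof. by move=> a b; rewrite /real_scale of_realD scalerDl. Qed.

HB.instance Definition _ := GRing.Zmodule_isLmodule.Build R realification
  real_scaleA real_scale1 real_scaleDr real_scaleDl.

End restriction_of_scalars.

Lemma norming_real_functional (R : realType) (s : scalars)
    (X : normedModType (scalar_field R s)) (v : X) :
  exists u : X -> R, [/\ {morph u : x y / x + y},
    forall a x, u (of_real s a *: x) = a * u x,
    forall x, `|u x| <= rnorm x & u v = rnorm v].
Proof.
have sn : sublinear (fun x : realification X => rnorm (x : X)).
  split=> [x y|a x a0]; first exact: rnormD.
  by rewrite (rnormZ (of_real s a) (x : X)) rnorm_of_real// ltW.
have [u [lu un uv]] := hahn_banach (v : realification X) sn.
have uD x y : u (x + y) = u x + u y.
  by rewrite -[x]scale1r lu mul1r scale1r.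
have u0 : u 0 = 0 by have := uD 0 0; rewrite addr0; lra.
have uZ a x : u (a *: x) = a * u x.
  by rewrite -[a *: x]addr0 lu u0 addr0.
exists u; split=> //.
move=> x; rewrite ler_norml un andbT lerNl.
by rewrite -(rnormN (x : X)) -mulN1r -uZ scaleN1r; exact: un.
Qed.

(** Over the complex numbers, psi x = u x - i u (i x) is complex linear when u
    is real linear, and its real part is u. *)
Lemma functional_neq0 (R : realType) (s : scalars)
    (X : normedModType (scalar_field R s)) (v : X) : v != 0 ->
  exists2 psi : X -> (scalar_field R s)^o, bounded_operator psi & psi v != 0.
Proof.
move=> /rnorm_gt0 v0; have [u [uD uZ un uv]] := norming_real_functional v.
case: s X v u uD uZ un uv v0 => X v u uD uZ un uv v0.
  exists u; last by rewrite uv gt_eqF.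
  split; first by move=> a x y; rewrite uD uZ.
  by exists 1 => x; rewrite mul1r; exact: un.
have uZ' a x : u (a%:C%C *: x) = a * u x := uZ a x.
pose psi x : R[i] := (u x +i* - u ('i *: x))%C.
have psiD x y : psi (x + y) = psi x + psi y.
  by rewrite /psi scalerDr !uD; apply/eqP; rewrite eq_complex/= opprD !eqxx.
have psiR a x : psi (a%:C%C *: x) = a%:C%C * psi x.
  rewrite /psi scalerA mulrC -scalerA !uZ'.
  by apply/eqP; rewrite eq_complex/=; apply/andP; split; apply/eqP; ring.
have psiI x : psi ('i%C *: x) = 'i%C * psi x.
  rewrite /psi scalerA.
  have -> : 'i%C * 'i%C = - 1 :> R[i] by rewrite -expr2 sqr_i.
  rewrite scaleN1r; have -> : u (- x) = - u x.
    by have := uD x (- x); rewrite subrr; have := uD 0 0; rewrite addr0; lra.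
  by apply/eqP; rewrite eq_complex/=; apply/andP; split; apply/eqP; ring.
exists psi.
  split=> [a x y|].
    rewrite psiD; congr (_ + _); rewrite [a in LHS]complexE scalerDl psiD.
    by rewrite psiR -scalerA psiI psiR mulrA -mulrDl -complexE.
  exists 2 => x; have nI : rnorm ('i%C *: x : X) = rnorm x.
    by rewrite rnormZ /rnorm normc_def/= expr0n add0r expr1n sqrtr1 mul1r.
  have := un x; have := un ('i%C *: x : X); rewrite nI !ler_norml.
  move=> /andP[? ?] /andP[? ?].
  have r0 := rnorm_ge0 x.
  have -> : rnorm (psi x : (scalar_field R ComplexScalars)^o) =
            Num.sqrt (u x ^+ 2 + u ('i%C *: x) ^+ 2).
    by rewrite /rnorm normc_def/= sqrrN.
  have -> : 2 * rnorm x = Num.sqrt ((2 * rnorm x) ^+ 2).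
    by rewrite sqrtr_sqr ger0_norm// mulr_ge0.
  by apply: ler_wsqrtr; nra.
apply/eqP => pv0; have uv0 : u v = 0 := congr1 (@complex.Re R) pv0.
by move: v0; rewrite -uv uv0 ltxx.
Qed.

(** * Closed subspaces as Banach spaces *)

Record closed_submodule (K : numFieldType) (Y : normedModType K) :=
  ClosedSubmodule {
    carrier : set Y ;
    carrier_submod : submod_closed [pred y | y \in carrier] ;
    carrier_closed : closed carrier
  }.

Section closed_submodule_type.
Variables (K : numFieldType) (Y : completeNormedModType K)
  (C : closed_submodule Y).

Definition in_submodule : {pred Y} := [pred y | y \in carrier C].

HB.instance Definition _ :=
  GRing.isSubmodClosed.Build K Y in_submodule (carrier_submod C).

(** A dedicated subtype, because the generic type of elements of a set carries
    a topology of its own, whereas here the topology has to come from the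
    restricted norm. *)
Record submodule_type :=
  Submodule { submodule_val : Y ; _ : submodule_val \in in_submodule }.

HB.instance Definition _ := [isSub for submodule_val].
HB.instance Definition _ := [Choice of submodule_type by <:].
HB.instance Definition _ :=
  [SubChoice_isSubLmodule of submodule_type by <:].

Definition submodule_norm (y : submodule_type) : K := `|submodule_val y|.

Lemma submodule_normD x y :
  submodule_norm (x + y) <= submodule_norm x + submodule_norm y.
Proof. exact: ler_normD. Qed.

Lemma submodule_normZ a x : submodule_norm (a *: x) = `|a| * submodule_norm x.
Proof. exact: normrZ. Qed.

Lemma submodule_norm_eq0 x : submodule_norm x = 0 -> x = 0.
Proof. by move=> /normr0_eq0 x0; apply: val_inj. Qed.

HB.instance Definition _ := Lmodule_isNormed.Build K submodule_type
  submodule_normD submodule_normZ submodule_norm_eq0.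

(** A Cauchy filter converges in the ambient space, and its limit stays in the
    subspace because the latter is closed. *)
Lemma submodule_complete (F : set_system submodule_type) :
  ProperFilter F -> cauchy F -> cvg F.
Proof.
move=> PF /cauchyP Fc.
have : cvg (submodule_val @ F).
  apply/cauchy_cvgP/cauchyP => e e0; have [x Fx] := Fc e e0.
  exists (submodule_val x); apply: filterS Fx => y; rewrite -!ball_normE; exact: id.
move=> /cvg_ex[l Fl].
have FC : \forall y \near F, carrier C (submodule_val y).
  by apply: nearW => -[y yC]; exact: set_mem yC.
have Cl : l \in in_submodule.
  by apply: mem_set; exact: closed_cvg (@carrier_closed _ _ C) FC _ Fl.
apply/cvg_ex; exists (Submodule Cl); apply/cvgrPdist_lt => e e0.
by have /cvgrPdist_lt/(_ e e0) := Fl.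
Qed.

HB.instance Definition _ :=
  Uniform_isComplete.Build submodule_type submodule_complete.

End closed_submodule_type.


(** * Finite rank operators as sums of rank one operators *)

Section bounded_operators.
Variables (R : realType) (s : scalars).
Notation K := (scalar_field R s).
Implicit Types W X Y Z : normedModType K.

Lemma linear_opD X Y (T : X -> Y) x y : linear T -> T (x + y) = T x + T y.
Proof. by move=> lT; rewrite -[x]scale1r lT !scale1r. Qed.

Lemma linear_op0 X Y (T : X -> Y) : linear T -> T 0 = 0.
Proof.
by move=> lT; apply: (addrI (T 0)); rewrite -linear_opD// !addr0.
Qed.

Lemma linear_opZ X Y (T : X -> Y) a x : linear T -> T (a *: x) = a *: T x.
Proof. by move=> lT; rewrite -[a *: x]addr0 lT linear_op0// addr0. Qed.

Lemma linear_opB X Y (T : X -> Y) x y : linear T -> T (x - y) = T x - T y.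
Proof.
by move=> lT; rewrite linear_opD// -scaleN1r linear_opZ// scaleN1r.
Qed.

Lemma bounded_nneg X Y (T : X -> Y) : bounded_operator T ->
  exists2 M, 0 <= M & forall x, rnorm (T x) <= M * rnorm x.
Proof.
move=> [_ [M TM]]; exists `|M| => // x.
by apply: le_trans (TM x) _; rewrite ler_wpM2r ?rnorm_ge0// ler_norm.
Qed.

Lemma bounded_isometry X Y (J : X -> Y) :
  isometric_embedding J -> bounded_operator J.
Proof. by move=> [lJ nJ]; split=> //; exists 1 => x; rewrite mul1r /rnorm nJ. Qed.

Lemma bounded_id X : bounded_operator (@idfun X).
Proof. exact: bounded_isometry. Qed.

Lemma bounded_comp X Y Z (T : X -> Y) (V : Y -> Z) :
  bounded_operator T -> bounded_operator V -> bounded_operator (V \o T).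
Proof.
move=> bT bV; split=> [a x y /=|]; first by rewrite bT.1 bV.1.
have [M M0 TM] := bounded_nneg bT; have [N N0 VN] := bounded_nneg bV.
exists (N * M) => x /=; apply: le_trans (VN _) _.
by rewrite -mulrA ler_wpM2l.
Qed.

Lemma boundedD X Y (T V : X -> Y) :
  bounded_operator T -> bounded_operator V -> bounded_operator (T \+ V).
Proof.
move=> [lT [M TM]] [lV [N VN]]; split=> [a x y /=|].
  by rewrite lT lV scalerDr addrACA.
exists (M + N) => x /=; apply: le_trans (rnormD _ _) _.
by rewrite mulrDl lerD.
Qed.

Lemma boundedB X Y (T V : X -> Y) :
  bounded_operator T -> bounded_operator V -> bounded_operator (T \- V).
Proof.
move=> bT [lV [N VN]]; apply: (boundedD bT (V := \- V)); split.
  by move=> a x y /=; rewrite lV scalerN opprD.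
by exists N => x /=; rewrite rnormN.
Qed.

Lemma bounded_rank_one X Y (phi : X -> K^o) (y : Y) :
  bounded_operator phi -> bounded_operator (rank_one phi y).
Proof.
move=> [lphi [M phiM]]; split=> [a x z|].
  by rewrite /rank_one lphi scalerDl scalerA.
exists (M * rnorm y) => x.
by rewrite /rank_one rnormZ mulrAC ler_wpM2r ?rnorm_ge0.
Qed.

Lemma bounded_continuous X Y (T : X -> Y) : bounded_operator T -> continuous T.
Proof.
move=> bT x; have [M M0 TM] := bounded_nneg bT.
apply/cvg_rnormP => e e0.
have : \forall z \near x, rnorm (z - x) < e / (M + 1).
  apply: (iffLR (cvg_rnormP _ _ _)); first exact: cvg_id.
  by rewrite divr_gt0// ltr_wpDl.
apply: filterS => z; rewrite ltr_pdivlMr ?ltr_wpDl// => zx.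
rewrite -linear_opB; last exact: bT.1.
by apply: le_lt_trans (TM _) _; have := rnorm_ge0 (z - x); lra.
Qed.

(** Finite rank operators in the form of tensors in X^* (x) Y, set up
    inductively so that estimates in an ideal norm go by induction on the number
    of terms. *)
Inductive rank_one_sum X Y : (X -> Y) -> Prop :=
| rank_one_sum0 : rank_one_sum (fun=> 0)
| rank_one_sumD phi y U : bounded_operator phi -> rank_one_sum U ->
    rank_one_sum (rank_one phi y \+ U).

Lemma rank_one_sum_bounded X Y (U : X -> Y) :
  rank_one_sum U -> bounded_operator U.
Proof.
elim=> [|phi y V bphi _ bV]; last by apply: boundedD => //; exact: bounded_rank_one.
split=> [a x y|]; first by rewrite scaler0 addr0.
by exists 0 => x; rewrite rnorm0 mul0r.
Qed.

Lemma rank_one_sum_compr W X Y (U : X -> Y) (V : W -> X) :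
  rank_one_sum U -> bounded_operator V -> rank_one_sum (U \o V).
Proof.
move=> rU bV; elim: rU => [|phi y U' bphi _ rU']; first exact: rank_one_sum0.
by apply: (rank_one_sumD (phi := phi \o V)) => //; exact: bounded_comp.
Qed.

Lemma rank_one_sum_add X Y (U V : X -> Y) :
  rank_one_sum U -> rank_one_sum V -> rank_one_sum (U \+ V).
Proof.
move=> rU rV; elim: rU => [|phi y U' bphi _ rUV].
  by have -> : (fun=> 0) \+ V = V by apply/funext => x /=; rewrite add0r.
have -> : rank_one phi y \+ U' \+ V = rank_one phi y \+ (U' \+ V).
  by apply/funext => x /=; rewrite addrA.
exact: rank_one_sumD.
Qed.

Lemma rank_one_sum_finite_rank X Y (U : X -> Y) :
  rank_one_sum U -> finite_rank U.
Proof.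
move=> rU; split; first exact: rank_one_sum_bounded.
elim: rU => [|phi y V bphi _ [n [z Vz]]].
  exists 0%N, (fun=> 0) => x; exists (fun=> 0).
  by rewrite big_ord0.
exists n.+1, (fun i => if unlift ord0 i is Some j then z j else y) => x.
have [c Vx] := Vz x.
exists (fun i => if unlift ord0 i is Some j then c j else phi x).
rewrite big_ord_recl unlift_none /= Vx; congr (_ + _).
by apply: eq_bigr => i _; rewrite liftK.
Qed.

(** One more point v is added to the fixed ones by correcting P with
    psi (x - P x) w, where w = v - P v is the defect at v and psi w = 1: the
    correction vanishes wherever P already fixes x. *)
Lemma rank_one_sum_fixing X (xs : seq X) :
  exists2 P : X -> X, rank_one_sum P & {in xs, forall x, P x = x}.
Proof.
elim: xs => [|v xs [P rP Pxs]]; first by exists (fun=> 0); [exact: rank_one_sum0|].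
have bP := rank_one_sum_bounded rP.
have [Pv|] := eqVneq (v - P v) 0.
  exists P => // x; rewrite inE => /predU1P[->|]; last exact: Pxs.
  by apply/esym/eqP; rewrite -subr_eq0 Pv.
move=> /functional_neq0[psi bpsi psiv].
pose w := v - P v.
exists (rank_one (psi \o (idfun \- P)) ((psi w)^-1 *: w) \+ P).
  apply: rank_one_sumD => //.
  by apply: bounded_comp bpsi; apply: boundedB => //; exact: bounded_id.
move=> x; rewrite inE /rank_one /= => /predU1P[->|xxs].
  by rewrite -/w scalerA divff// scale1r subrK.
by rewrite Pxs// subrr (linear_op0 bpsi.1) scale0r add0r.
Qed.

(** If P = sum of phi_i (.) e_i fixes a spanning set of the range of U, then
    U = P U = sum of (phi_i U) (.) e_i. *)
Lemma finite_rank_sum X Y (U : X -> Y) : finite_rank U -> rank_one_sum U.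
Proof.
move=> [bU [n [y Uy]]].
have [P rP Py] := rank_one_sum_fixing [seq y i | i <- enum 'I_n].
suff -> : U = P \o U by exact: rank_one_sum_compr.
apply/funext => x /=; have [c ->] := Uy x.
have lP := (rank_one_sum_bounded rP).1.
elim/big_rec : _ => [|i z _ zP]; first by rewrite linear_op0.
rewrite lP -zP Py//; apply/mapP; exists i => //; exact: mem_enum.
Qed.

End bounded_operators.

(** * Corestriction to the closure of the range *)

Section closed_range.
Variables (R : realType) (s : scalars).
Notation K := (scalar_field R s).

Lemma closure_rnormP (Y : normedModType K) (A : set Y) (y : Y) :
  closure A y <-> forall e : R, 0 < e -> exists2 z, A z & rnorm (z - y) < e.
Proof.
split=> [cAy e e0|Ay B].
  have [|z [Az zy]] := cAy [set z | rnorm (z - y) < e].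
    exact: (iffLR (cvg_rnormP _ _ _) (@cvg_id _ (nbhs y))).
  by exists z.
move=> /nbhs_ballP[d /= d0 dB].
have [|z Az zy] := Ay (scalar_re d).
  by rewrite -(ltr_of_real s) of_real0 scalar_reK// ltW.
exists z; split=> //; apply: dB; rewrite -ball_normE /ball_/=.
by rewrite distrC -(scalar_reK (ltW d0)) norm_rnorm ltr_of_real.
Qed.

Variables (X Y : banachType R s) (T : X -> Y) (bT : bounded_operator T).

Lemma closed_range_submod :
  submod_closed [pred y | y \in closure (range T)].
Proof.
split=> [|a y z]; rewrite !inE.
  by apply: subset_closure; exists 0 => //; rewrite linear_op0//; exact: bT.1.
move=> /closure_rnormP Ty /closure_rnormP Tz; apply/closure_rnormP => e e0.
pose c := rnorm (a : K^o) + 1.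
have c0 : 0 < c by rewrite ltr_wpDl ?rnorm_ge0.
have [|_ [x _ <-] xy] := Ty (e / 2 / c); first by rewrite !divr_gt0.
have [|_ [w _ <-] wz] := Tz (e / 2); first by rewrite divr_gt0.
exists (T (a *: x + w)); first by exists (a *: x + w).
rewrite bT.1 opprD addrACA -scalerBr; apply: le_lt_trans (rnormD _ _) _.
rewrite rnormZ; move: xy; rewrite ltr_pdivlMr// /c.
have := rnorm_ge0 (T x - y); nra.
Qed.

Definition closed_range : closed_submodule Y :=
  ClosedSubmodule closed_range_submod (@closed_closure _ (range T)).

Lemma in_closed_range x : T x \in in_submodule closed_range.
Proof. by apply: mem_set; apply: subset_closure; exists x. Qed.

Definition corestriction x : submodule_type closed_range :=
  Submodule (in_closed_range x).

Lemma corestriction_bounded : bounded_operator corestriction.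
Proof.
have [lT [M TM]] := bT; split=> [a x y|]; first exact/val_inj/lT.
by exists M => x; exact: TM.
Qed.

Lemma corestriction_dense (y : submodule_type closed_range) (e : R) : 0 < e ->
  exists x, rnorm (corestriction x - y) < e.
Proof.
case: y => y yT e0; have /closure_rnormP/(_ e e0) := set_mem yT.
by move=> [_ [x _ <-] xy]; exists x.
Qed.

Lemma submodule_val_isometry (C : closed_submodule Y) :
  isometric_embedding (@submodule_val _ _ C).
Proof. by split. Qed.

End closed_range.

(** * Nets *)

Lemma dir_tails_filter (D : directedType) : ProperFilter (dir_tails D).
Proof.
have [a0] := dir_inhabited D.
apply: filter_from_proper => [|a _]; last by exists a; exact: dir_refl.
apply: filter_from_filter; first by exists a0.
move=> a b _ _; have [c [ac bc]] := dir_ub a b; exists c => //= d cd.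
by split; exact: dir_trans cd.
Qed.

Lemma net_limsup_le (R : realType) (D : directedType) (f : D -> R) (c : R) :
  (net_limsup f <= c%:E)%E <->
  forall e, 0 < e -> \forall a \near dir_tails D, f a <= c + e.
Proof.
split=> [fc e e0|fc].
  have : (net_limsup f < (c + e)%:E)%E.
    by apply: le_lt_trans fc _; rewrite lte_fin ltrDl.
  move=> /ereal_inf_lt[_ [a _ <-] fa]; exists a => // b /= ab.
  rewrite -lee_fin; apply: le_trans (ltW fa).
  by apply: ereal_sup_ubound; exists b.
apply/lee_addgt0Pr => e e0; have [a _ fa] := fc e e0.
apply: (@le_trans _ _ (ereal_sup [set (f b)%:E | b in [set b | dir_le a b]])).
  by apply: ereal_inf_lbound; exists a.
by apply: ge_ereal_sup => _ [b /= ab <-]; rewrite -EFinD lee_fin; exact: fa.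
Qed.

(** * Finite rank operators in a Banach ideal *)

Section ideal.
Variables (R : realType) (s : scalars) (A : banach_ideal R s).
Notation K := (scalar_field R s).
Implicit Types W X Y : banachType R s.

Lemma ideal_mem0 X Y : ideal_mem A (fun _ : X => 0 : Y).
Proof.
have b0 : bounded_operator (fun _ : X => 0 : K^o).
  exact: rank_one_sum_bounded (@rank_one_sum0 _ _ _ _).
have := ideal_mem_rank_one A (0 : Y) b0; congr (ideal_mem _ _).
by apply/funext => x; rewrite /rank_one scaler0.
Qed.

Lemma ideal_norm0 X Y : ideal_norm A (fun _ : X => 0 : Y) = 0.
Proof.
have := ideal_normZ (0 : K) (ideal_mem0 X Y).
have -> : (0 : K) \*: (fun _ : X => 0 : Y) = (fun=> 0).
  by apply/funext => x /=; rewrite scale0r.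
by move->; have := @rnorm0 R s K^o; rewrite /rnorm => ->; rewrite mul0r.
Qed.

Lemma ideal_mem_rank_one_sum X Y (U : X -> Y) :
  rank_one_sum U -> ideal_mem A U.
Proof.
elim=> [|phi y V bphi _ mV]; first exact: ideal_mem0.
by apply: ideal_memD => //; exact: ideal_mem_rank_one.
Qed.

Lemma ideal_mem_compr W X Y (T : X -> Y) (U : W -> X) :
  bounded_operator U -> ideal_mem A T -> ideal_mem A (T \o U).
Proof.
by move=> bU mT; exact: (ideal_mem_comp bU mT (bounded_id Y)).
Qed.

Lemma ideal_memB X Y (T U : X -> Y) :
  ideal_mem A T -> ideal_mem A U -> ideal_mem A (T \- U).
Proof.
move=> mT mU; have -> : T \- U = T \+ (-1 : K) \*: U.
  by apply/funext => x /=; rewrite scaleN1r.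
by apply: ideal_memD => //; exact: ideal_memZ.
Qed.

(** The factor `|opnorm phi| + 1 rather than opnorm phi, so that it is positive
    and one can divide by it. *)
Lemma ideal_norm_rank_oneD X Y (phi : X -> K^o) (y : Y) (U : X -> Y) :
  bounded_operator phi -> ideal_mem A U ->
  ideal_norm A (rank_one phi y \+ U) <=
    (`|opnorm phi| + 1) * rnorm y + ideal_norm A U.
Proof.
move=> bphi mU.
apply: le_trans (ideal_normD (ideal_mem_rank_one A y bphi) mU) _.
rewrite lerD2r (ideal_norm_rank_one A y bphi) ler_wpM2r ?rnorm_ge0//.
by have := ler_norm (opnorm phi); lra.
Qed.

(** Composing with a fixed finite rank operator on the right turns pointwise
    convergence into convergence in the ideal norm, because
    V_i (phi (.) x) = phi (.) (V_i x) has ideal norm |phi| |V_i x|. *)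
Lemma ideal_norm_net_comp W X Y (P : W -> X) (I : Type) (F : set_system I)
    (V : I -> X -> Y) :
  Filter F -> rank_one_sum P -> (forall i, bounded_operator (V i)) ->
  (forall x, V i x @[i --> F] --> 0) ->
  forall e, 0 < e -> \forall i \near F, ideal_norm A (V i \o P) <= e.
Proof.
move=> FF rP bV V0; elim: rP => [|phi x U bphi rU IH] e e0.
  apply: nearW => i; have -> : V i \o (fun _ : W => 0 : X) = (fun=> 0).
    by apply/funext => x /=; rewrite (linear_op0 (bV i).1).
  by rewrite ideal_norm0 ltW.
have c0 : 0 < `|opnorm phi| + 1 by rewrite ltr_wpDl.
have Vx : \forall i \near F, rnorm (V i x - 0) < e / 2 / (`|opnorm phi| + 1).
  by apply: (iffLR (cvg_rnormP _ _ _) (V0 x)); rewrite !divr_gt0.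
have := IH (e / 2); rewrite divr_gt0// => /(_ isT).
apply: filterS2 Vx => i; rewrite subr0 ltr_pdivlMr// => Vx VU.
have -> : V i \o (rank_one phi x \+ U) = rank_one phi (V i x) \+ (V i \o U).
  apply/funext => w /=; rewrite /rank_one (linear_opD _ _ (bV i).1).
  by rewrite (linear_opZ _ _ (bV i).1).
have mVU : ideal_mem A (V i \o U).
  apply: (ideal_mem_comp (bounded_id W) _ (bV i)).
  exact: ideal_mem_rank_one_sum.
apply: le_trans (ideal_norm_rank_oneD _ bphi mVU) _; lra.
Qed.

(** The vectors y_j in U = sum of psi_j (.) y_j are replaced by approximations
    T x_j. The operator V in front is I - P in the application; it is part of
    the statement because the accuracy of T x_j has to be adjusted to the norms of
    psi_j V. *)
Lemma rank_one_sum_lift W W' X Y (T : X -> Y) (U : W' -> Y) (V : W -> W') :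
  bounded_operator T ->
  (forall y e, 0 < e -> exists x, rnorm (T x - y) < e) ->
  bounded_operator V -> rank_one_sum U ->
  forall e, 0 < e -> exists2 S : W' -> X, rank_one_sum S &
    ideal_norm A ((T \o S \- U) \o V) <= e.
Proof.
move=> bT dT bV; elim=> [|phi y U' bphi rU' IH] e e0.
  exists (fun=> 0); first exact: rank_one_sum0.
  have -> : (T \o (fun _ : W' => 0 : X) \- (fun=> 0)) \o V = (fun=> 0).
    by apply/funext => x /=; rewrite (linear_op0 bT.1) subrr.
  by rewrite ideal_norm0 ltW.
have bphiV : bounded_operator (phi \o V) by exact: bounded_comp.
have c0 : 0 < `|opnorm (phi \o V)| + 1 by rewrite ltr_wpDl.
have [|S rS SU] := IH (e / 2); first by rewrite divr_gt0.
have [|x] := dT y (e / 2 / (`|opnorm (phi \o V)| + 1)).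
  by rewrite !divr_gt0.
rewrite ltr_pdivlMr// => xy.
exists (rank_one phi x \+ S); first exact: rank_one_sumD.
have -> : (T \o (rank_one phi x \+ S) \- (rank_one phi y \+ U')) \o V =
    rank_one (phi \o V) (T x - y) \+ ((T \o S \- U') \o V).
  apply/funext => w /=; rewrite /rank_one (linear_opD _ _ bT.1).
  by rewrite (linear_opZ _ _ bT.1) opprD addrACA -scalerBr.
have mSU : ideal_mem A ((T \o S \- U') \o V).
  apply: ideal_mem_compr => //.
  apply: ideal_memB; last exact: ideal_mem_rank_one_sum.
  exact: (ideal_mem_comp (bounded_id W') (ideal_mem_rank_one_sum rS) bT).
apply: le_trans (ideal_norm_rank_oneD _ bphiV mSU) _; lra.
Qed.

(** One index a of the net is chosen where the norm of U a is almost at most c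
    and U a is close to T on the range of P; it is then corrected to
    P + S (I - P), where T S is close to U a. The three error terms get e / 3
    each. *)
Lemma dense_range_approximation X Y (T : X -> Y) (c : R) (D : directedType)
    (U : D -> X -> Y) (xs : seq X) :
  ideal_mem A T ->
  (forall y e, 0 < e -> exists x, rnorm (T x - y) < e) ->
  (forall a, finite_rank (U a)) ->
  (forall x, U a x @[a --> dir_tails D] --> T x) ->
  (net_limsup (fun a => ideal_norm A (U a)) <= c%:E)%E ->
  forall e, 0 < e -> exists S : X -> X,
    [/\ finite_rank S, {in xs, forall x, S x = x} &
        ideal_norm A (T \o S) <= c + e].
Proof.
move=> mT dT fU UT /net_limsup_le Uc e e0.
have bT := ideal_mem_bounded mT.
have [P rP Pxs] := rank_one_sum_fixing xs.
have bP := rank_one_sum_bounded rP.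
have DF := dir_tails_filter D.
have e3 : 0 < e / 3 by rewrite divr_gt0.
have bTU a : bounded_operator (T \- U a) by apply: boundedB => //; case: (fU a).
have TU0 x : (T \- U a) x @[a --> dir_tails D] --> 0.
  by rewrite -(subrr (T x)) /=; apply: cvgB => //; exact: cvg_cst.
have [a [/= Ua TUa]] := filter_ex (filterI (Uc _ e3)
  (ideal_norm_net_comp DF rP bTU TU0 e3)).
have bQ : bounded_operator (idfun \- P) by apply: boundedB => //; exact: bounded_id.
have rU := finite_rank_sum (fU a).
have [S rS SU] := rank_one_sum_lift bT dT bQ rU e3.
have rSQ := rank_one_sum_compr rS bQ.
exists (P \+ (S \o (idfun \- P))); split.
- by apply: rank_one_sum_finite_rank; exact: rank_one_sum_add.
- move=> x xxs /=; rewrite Pxs// subrr linear_op0 ?addr0//.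
  exact: (rank_one_sum_bounded rS).1.
have -> : T \o (P \+ (S \o (idfun \- P))) =
    U a \+ (((T \- U a) \o P) \+ ((T \o S \- U a) \o (idfun \- P))).
  apply/funext => x /=; rewrite (linear_opD _ _ bT.1).
  have -> : U a x = U a (P x) + U a (x - P x).
    by rewrite -linear_opD ?subrKC//; exact: (fU a).1.1.
  by rewrite addrACA !subrKC.
have mUa : ideal_mem A (U a) by exact: ideal_mem_rank_one_sum.
have mTS : ideal_mem A (T \o S).
  by apply: ideal_mem_compr => //; exact: rank_one_sum_bounded.
have mTUP : ideal_mem A ((T \- U a) \o P).
  by apply: ideal_mem_compr => //; exact: ideal_memB.
have mTSU : ideal_mem A ((T \o S \- U a) \o (idfun \- P)).
  by apply: ideal_mem_compr => //; exact: ideal_memB.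
apply: le_trans (ideal_normD mUa (ideal_memD mTUP mTSU)) _.
have := ideal_normD mTUP mTSU; lra.
Qed.

End ideal.

(** * The equivalence *)

Lemma weak_BAP_local (R : realType) (s : scalars) (A : banach_ideal R s)
    (lambda : R) (X : banachType R s) :
  weak_BAP lambda A X -> local_BAP lambda A X.
Proof.
move=> wX Y T mT; have [D [S [fS S1 limS]]] := wX Y T mT.
have bT := ideal_mem_bounded mT.
exists D, (fun a => T \o S a); split=> // [a|x].
  have [bS [n [y Sy]]] := fS a; split; first exact: bounded_comp.
  exists n, (T \o y) => x; have [k Sx] := Sy x; exists k; rewrite /= Sx.
  elim/big_rec2 : _ => [|i z w _ <-]; first by rewrite (linear_op0 bT.1).
  by rewrite bT.1.
apply: (@cvg_comp _ _ _ (fun a => S a x) T); first exact: S1.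
exact: bounded_continuous.
Qed.

(** Injectivity is used twice: it puts the corestriction T0 in the ideal, so that
    the local property applies to it, and it identifies the norms of T S and
    T0 S for the operators S obtained. *)
Lemma local_BAP_weak (R : realType) (s : scalars) (A : banach_ideal R s)
    (lambda : R) (X : banachType R s) :
  injective_ideal A -> local_BAP lambda A X -> weak_BAP lambda A X.
Proof.
move=> injA lX Y T mT; have bT := ideal_mem_bounded mT.
pose T0 := corestriction bT.
have [mT0 nT0] : ideal_mem A T0 /\ ideal_norm A T0 = ideal_norm A T.
  exact: (injA _ _ _ _ T0 (submodule_val_isometry _)
    (corestriction_bounded bT) mT).
have nS S : finite_rank S -> ideal_norm A (T \o S) = ideal_norm A (T0 \o S).
  move=> [bS _]; have mTS := ideal_mem_compr bS mT.
  by have [_ ->] := injA _ _ _ _ (T0 \o S) (submodule_val_isometry _)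
    (bounded_comp bS (corestriction_bounded bT)) mTS.
have [E [U [fU UT limU]]] := lX _ T0 mT0.
have approx (i : seq X * nat) : exists S : X -> X,
    [/\ finite_rank S, {in i.1, forall x, S x = x} &
      ideal_norm A (T \o S) <= lambda * ideal_norm A T + i.2.+1%:R^-1].
  have i0 : 0 < i.2.+1%:R^-1 :> R by rewrite invr_gt0.
  have [S [fS Sxs TS]] := dense_range_approximation i.1 mT0
    (@corestriction_dense _ _ _ _ _ bT) fU UT limU i0.
  by exists S; split=> //; rewrite nS// -nT0.
have [S SP] := choice approx.
pose le_D (i j : seq X * nat) := {subset i.1 <= j.1} /\ (i.2 <= j.2)%N.
have le_D_refl i : le_D i i by split.
have le_D_trans i j k : le_D i j -> le_D j k -> le_D i k.
  move=> [ij1 ij2] [jk1 jk2]; split; last exact: leq_trans jk2.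
  by move=> x /ij1/jk1.
have le_D_ub i j : exists k, le_D i k /\ le_D j k.
  exists (i.1 ++ j.1, maxn i.2 j.2); rewrite /le_D /= leq_maxl leq_maxr.
  by split; split=> // x xi; rewrite mem_cat xi ?orbT.
pose D := DirectedType (inhabits ([::], 0%N)) le_D_refl le_D_trans le_D_ub.
exists D, S; split=> [i|x|].
- by have [] := SP i.
- have FD := dir_tails_filter D; apply: cvg_near_cst.
  exists ([:: x], 0%N) => // j [xj _].
  by have [_ + _] := SP j; apply; apply: xj; exact: mem_head.
apply/net_limsup_le => e e0.
(* 1 / (n + 1) <= e *)
pose n := Num.truncn e^-1.
exists ([::], n) => // j [_ nj]; have [_ _] := SP j.
move/le_trans; apply; rewrite lerD2l.
rewrite -[leRHS]invrK lef_pV2 ?posrE ?invr_gt0//.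
apply: le_trans (ltW (truncnS_gt _)) _.
by rewrite ler_nat ltnS.
Qed.

Theorem theorem2p12 (R : realType) (s : scalars) (A : banach_ideal R s)
    (lambda : R) (X : banachType R s) :
  injective_ideal A -> 1 <= lambda ->
  (weak_BAP lambda A X <-> local_BAP lambda A X).
Proof.
move=> injA _; split; first exact: weak_BAP_local.
exact: local_BAP_weak.
Qed.
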